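(* Let $(X,r)$ be a solution. The abelianization of its structure group $G_{(X,r)}$ has rank $k_r$, where $k_r$ is the number of orbits of $(X,r)$.
   Context: A solution $(X,r)$ is a finite set $X$ with a bijection $r\colon X\times X\to X\times X$, $r(x,y)=(\sigma_x(y),\tau_y(x))$, satisfying the Yang--Baxter equation $r_1r_2r_1=r_2r_1r_2$ on $X^3$ ($r_1=r\times \mathrm{Id}_X$, $r_2=\mathrm{Id}_X\times r$), with all maps $\sigma_x,\tau_x\colon X\to X$ bijective. Its structure group is $G_{(X,r)}=\langle X \mid xy=\sigma_x(y)\tau_y(x),\ x,y\in X\rangle$. The orbits of $(X,r)$ are the orbits of $X$ under all the permutations $\sigma_z$ and $\tau_z$, $z\in X$. The rank of a finitely generated abelian group is the rank of its free part. *)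

(* Defs.v *)
From HB Require Import structures.
From mathcomp Require Import all_boot all_order all_algebra all_fingroup.
From mathcomp Require Import boolp.
(* Imported last because fingroup also has a repr. *)
From mathcomp Require Import generic_quotient.

Set Implicit Arguments.
Unset Strict Implicit.
Unset Printing Implicit Defensive.

Import GRing.Theory.

Local Open Scope group_scope.
Local Open Scope quotient_scope.

(* The letter (x, false) stands for x and (x, true) for its inverse, so that  *)
(* a word represents an element of the free group on X.                       *)
Definition word (X : Type) := seq (X * bool).

Definition letter (X : Type) (x : X) : word X := [:: (x, false)].

Definition word_inv (X : Type) (w : word X) : word X :=
  rev [seq (a.1, ~~ a.2) | a <- w].

(* The least congruence on words that cancels x x^-1 and x^-1 x and contains  *)
(* the defining relations R, where R u v reads "u = v".                       *)
Inductive pres_cong (X : Type) (R : word X -> word X -> Prop) :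
    word X -> word X -> Prop :=
| pres_refl u : pres_cong R u u
| pres_sym u v : pres_cong R u v -> pres_cong R v u
| pres_trans u v w : pres_cong R u v -> pres_cong R v w -> pres_cong R u w
| pres_cat u u' v v' :
    pres_cong R u u' -> pres_cong R v v' -> pres_cong R (u ++ v) (u' ++ v')
| pres_cancel x b : pres_cong R [:: (x, b); (x, ~~ b)] [::]
| pres_defrel u v : R u v -> pres_cong R u v.

Definition pres_congb (X : Type) (R : word X -> word X -> Prop) :
    rel (word X) := fun u v => `[< pres_cong R u v >].

Lemma pres_congb_refl X R : reflexive (@pres_congb X R).
Proof. by move=> u; apply/asboolP; apply: pres_refl. Qed.

Lemma pres_congb_sym X R : symmetric (@pres_congb X R).
Proof. by move=> u v; apply/asboolP/asboolP; apply: pres_sym. Qed.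

Lemma pres_congb_trans X R : transitive (@pres_congb X R).
Proof.
by move=> v u w /asboolP uv /asboolP vw; apply/asboolP; apply: pres_trans vw.
Qed.

Canonical pres_equiv X R := EquivRel (@pres_congb X R)
  (@pres_congb_refl X R) (@pres_congb_sym X R) (@pres_congb_trans X R).

Definition presented_group (X : choiceType) (R : word X -> word X -> Prop) :=
  {eq_quot (pres_equiv R)}.

HB.instance Definition _ X R := Choice.on (@presented_group X R).
HB.instance Definition _ X R := EqQuotient.on (@presented_group X R).

Definition pres_one X R : @presented_group X R :=
  \pi_(presented_group R) [::].
Definition pres_mul X R (a b : @presented_group X R) : presented_group R :=
  \pi_(presented_group R) (repr a ++ repr b).
Definition pres_inv X R (a : @presented_group X R) : presented_group R :=
  \pi_(presented_group R) (word_inv (repr a)).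

Lemma pi_presP (X : choiceType) (R : word X -> word X -> Prop)
    (u v : word X) :
  \pi_(@presented_group X R) u = \pi_(@presented_group X R) v <->
  pres_cong R u v.
Proof.
by split=> [/eqmodP/asboolP | uv] //; apply/eqmodP/asboolP.
Qed.

Lemma repr_pres (X : choiceType) (R : word X -> word X -> Prop)
    (u : word X) :
  pres_cong R (repr (\pi_(@presented_group X R) u)) u.
Proof. by apply/pi_presP; rewrite reprK. Qed.

Lemma pres_mulA (X : choiceType) (R : word X -> word X -> Prop) :
  associative (@pres_mul X R).
Proof.
move=> a b c; apply/pi_presP.
apply: (@pres_trans _ _ _ (repr a ++ (repr b ++ repr c))).
  by apply: pres_cat; [apply: pres_refl | apply: repr_pres].
rewrite catA; apply: pres_cat; last exact: pres_refl.
by apply: pres_sym; apply: repr_pres.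
Qed.

Lemma pres_mul1 (X : choiceType) (R : word X -> word X -> Prop) :
  left_id (@pres_one X R) (@pres_mul X R).
Proof.
move=> a; rewrite -[RHS]reprK; apply/pi_presP.
rewrite -[X in pres_cong _ _ X]cat0s.
by apply: pres_cat; [apply: repr_pres | apply: pres_refl].
Qed.

Lemma pres_mulr1 (X : choiceType) (R : word X -> word X -> Prop) :
  right_id (@pres_one X R) (@pres_mul X R).
Proof.
move=> a; rewrite -[RHS]reprK; apply/pi_presP.
rewrite -[X in pres_cong _ _ X]cats0.
by apply: pres_cat; [apply: pres_refl | apply: repr_pres].
Qed.

Lemma word_invK X : involutive (@word_inv X).
Proof.
move=> w; rewrite /word_inv map_rev revK -map_comp.
by rewrite -[RHS]map_id; apply: eq_map => -[x b] /=; rewrite negbK.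
Qed.

Lemma pres_cong_catV X (R : word X -> word X -> Prop) (w : word X) :
  pres_cong R (w ++ word_inv w) [::].
Proof.
elim: w => [|[x b] w IHw]; first exact: pres_refl.
have -> : word_inv ((x, b) :: w) = word_inv w ++ [:: (x, ~~ b)].
  by rewrite /word_inv map_cons rev_cons cats1.
rewrite -cat1s -catA [w ++ _]catA.
apply: pres_trans (pres_cancel R x b).
rewrite -[X in pres_cong _ _ X]/([:: (x, b)] ++ ([::] ++ [:: (x, ~~ b)])).
apply: pres_cat; first exact: pres_refl.
by apply: pres_cat => //; apply: pres_refl.
Qed.

Lemma pres_mulV (X : choiceType) (R : word X -> word X -> Prop) :
 
  left_inverse (@pres_one X R) (@pres_inv X R) (@pres_mul X R).
Proof.
move=> a; apply/pi_presP.
apply: (@pres_trans _ _ _ (word_inv (repr a) ++ repr a)).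
  by apply: pres_cat; [apply: repr_pres | apply: pres_refl].
rewrite -[X in _ ++ X]word_invK; exact: pres_cong_catV.
Qed.

Lemma pres_mulrV (X : choiceType) (R : word X -> word X -> Prop) :
 
  right_inverse (@pres_one X R) (@pres_inv X R) (@pres_mul X R).
Proof.
move=> a; apply/pi_presP.
apply: (@pres_trans _ _ _ (repr a ++ word_inv (repr a))).
  by apply: pres_cat; [apply: pres_refl | apply: repr_pres].
exact: pres_cong_catV.
Qed.

HB.instance Definition _ X R := isGroup.Build (@presented_group X R)
  (@pres_mulA X R) (@pres_mul1 X R) (@pres_mulr1 X R)
  (@pres_mulV X R) (@pres_mulrV X R).

(* Membership in the subgroup [G, G] generated by the commutators. *)
Inductive derived (G : groupType) : G -> Prop :=
| derived_one : derived 1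
| derived_mul x y : derived x -> derived y -> derived (x * y)
| derived_inv x : derived x -> derived x^-1
| derived_comm x y : derived [~ x, y].

Definition ab_congb (G : groupType) : rel G :=
  fun x y => `[< derived (x^-1 * y) >].

Lemma ab_congb_refl G : reflexive (@ab_congb G).
Proof. by move=> x; apply/asboolP; rewrite mulVg; apply: derived_one. Qed.

Lemma ab_congb_sym G : symmetric (@ab_congb G).
Proof.
by move=> x y; apply/asboolP/asboolP => /derived_inv; rewrite invgM invgK.
Qed.

Lemma ab_congb_trans G : transitive (@ab_congb G).
Proof.
move=> y x z /asboolP xy /asboolP yz; apply/asboolP.
by move: (derived_mul xy yz); rewrite mulgA mulgK.
Qed.

Canonical ab_equiv (G : groupType) := EquivRel (@ab_congb G)
  (@ab_congb_refl G) (@ab_congb_sym G) (@ab_congb_trans G).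

(* The abelianization G / [G, G], an abelian group written additively. *)
Definition abelianization (G : groupType) := {eq_quot (ab_equiv G)}.

HB.instance Definition _ G := Choice.on (abelianization G).
HB.instance Definition _ G := EqQuotient.on (abelianization G).

Definition ab_zero G : abelianization G :=
  \pi_(abelianization G) 1.
Definition ab_add G (a b : abelianization G) : abelianization G :=
  \pi_(abelianization G) (repr a * repr b).
Definition ab_opp G (a : abelianization G) : abelianization G :=
  \pi_(abelianization G) (repr a)^-1.

Lemma pi_abP (G : groupType) (x y : G) :
  \pi_(abelianization G) x = \pi_(abelianization G) y <->
  derived (x^-1 * y).
Proof. by split=> [/eqmodP/asboolP | xy] //; apply/eqmodP/asboolP. Qed.

Lemma derivedJ (G : groupType) (x y : G) : derived x -> derived (x ^ y).
Proof.
move=> dx; rewrite -[x ^ y](mulKVg x); apply: derived_mul => //.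
exact: derived_comm.
Qed.

Lemma pi_abM (G : groupType) (x x' y y' : G) :
  derived (x^-1 * x') -> derived (y^-1 * y') ->
  derived ((x * y)^-1 * (x' * y')).
Proof.
move=> dx dy; have := derived_mul (derivedJ y dx) dy.
by rewrite /conjg invgM !mulgA mulgK.
Qed.

Lemma repr_ab (G : groupType) (x : G) :
  derived ((repr (\pi_(abelianization G) x))^-1 * x).
Proof. by apply/pi_abP; rewrite reprK. Qed.

Lemma derived_refl (G : groupType) (x : G) : derived (x^-1 * x).
Proof. by rewrite mulVg; apply: derived_one. Qed.

Lemma pi_ab_add (G : groupType) (x y : G) :
  ab_add (\pi x) (\pi y) = \pi_(abelianization G) (x * y).
Proof. by apply/pi_abP; apply: pi_abM; apply: repr_ab. Qed.

Lemma ab_addA G : associative (@ab_add G).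
Proof.
move=> a b c; rewrite -[a]reprK -[b]reprK -[c]reprK.
by rewrite !pi_ab_add mulgA.
Qed.

Lemma ab_addC G : commutative (@ab_add G).
Proof.
move=> a b; rewrite -[a]reprK -[b]reprK !pi_ab_add; apply/pi_abP.
rewrite invgM -mulgA; have := derived_comm (repr b) (repr a).
by rewrite /commg /conjg.
Qed.

Lemma ab_add0 G : left_id (@ab_zero G) (@ab_add G).
Proof. by move=> a; rewrite -[a]reprK pi_ab_add mul1g. Qed.

Lemma ab_addN G : left_inverse (@ab_zero G) (@ab_opp G) (@ab_add G).
Proof. by move=> a; rewrite -{2}[a]reprK pi_ab_add mulVg. Qed.

HB.instance Definition _ G := GRing.isZmodule.Build (abelianization G)
  (@ab_addA G) (@ab_addC G) (@ab_add0 G) (@ab_addN G).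

(* A is finitely generated with free part Z^n: it is isomorphic to the direct *)
(* sum of Z^n and a finite abelian group.                                     *)
Definition has_rank (A : zmodType) (n : nat) : Prop :=
  exists (T : finZmodType) (f : {additive A -> 'rV[int]_n * T}), bijective f.

Definition sigma (X : Type) (r : X * X -> X * X) (x y : X) : X := (r (x, y)).1.
Definition tau (X : Type) (r : X * X -> X * X) (y x : X) : X := (r (x, y)).2.

Definition on12 (X : Type) (r : X * X -> X * X) (p : X * X * X) : X * X * X :=
  (r (p.1.1, p.1.2), p.2).

Definition on23 (X : Type) (r : X * X -> X * X) (p : X * X * X) : X * X * X :=
  let q := r (p.1.2, p.2) in (p.1.1, q.1, q.2).

Definition yang_baxter (X : Type) (r : X * X -> X * X) : Prop :=
  on12 r \o on23 r \o on12 r =1 on23 r \o on12 r \o on23 r.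

Definition is_solution (X : finType) (r : X * X -> X * X) : Prop :=
  [/\ bijective r, yang_baxter r, forall x, bijective (sigma r x)
    & forall y, bijective (tau r y)].

Inductive structure_rel (X : Type) (r : X * X -> X * X) :
    word X -> word X -> Prop :=
| StructureRel x y : structure_rel r (letter x ++ letter y)
    (letter (sigma r x y) ++ letter (tau r y x)).

Definition structure_group (X : finType) (r : X * X -> X * X) : groupType :=
  presented_group (structure_rel r).

(* When r is a solution, every sigma r z and every tau r z is a bijection and  *)
(* hence equal to some s : {perm X}.                                           *)
Definition sigma_tau_perms (X : finType) (r : X * X -> X * X) :
    {set {perm X}} :=
  [set s : {perm X} | [exists z,
    [forall x, s x == sigma r z x] || [forall x, s x == tau r z x]]].

Definition orbits (X : finType) (r : X * X -> X * X) : {set {set X}} :=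
  [set orbit 'P <<sigma_tau_perms r>> x | x : X].

(* Main.v *)
Require Import Defs.
From mathcomp Require Import all_boot all_order all_algebra all_fingroup.
From HB Require Import structures.
From mathcomp Require Import boolp generic_quotient.

Set Implicit Arguments.
Unset Strict Implicit.
Unset Printing Implicit Defensive.

Import GRing.Theory Num.Theory.
Local Open Scope ring_scope.
Local Open Scope quotient_scope.

(** Write A for the abelianization of the structure group: it is generated by
    X, subject to x + y = sigma_x y + tau_y x.

    Sending each letter to the basis vector of its orbit is compatible with
    these relations, because sigma_x y lies in the orbit of y and tau_y x in
    the orbit of x. This gives f : A -> Z^k, which is split by sending each
    basis vector to a letter of that orbit. So A is Z^k plus the kernel of f,
    and the kernel is generated by the differences x - x' of letters in the
    same orbit. It remains to show that these finitely many differences are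
    torsion (orbit_torsion).

    A rational linear-algebra duality (torsion_of_annihilators) reduces this
    to showing that every phi : X -> Q satisfying
    phi x + phi y = phi (sigma_x y) + phi (tau_y x) is constant on orbits
    (sigma_tau_invariant). Summing that identity over y, the permutation
    sigma_x cancels the terms phi y against the terms phi (sigma_x y), and
    phi x is the mean of the values phi (tau_y x). So phi is harmonic for the
    random walk on X that applies a random permutation tau_y. Such a walk
    preserves the uniform measure, so that
    sum_(x, y) (phi (tau_y x) - phi x)^2 expands to
    N - 2 N + N = 0 with N = |X| sum_x (phi x)^2. Hence phi is invariant under
    each tau_y, and then, by the identity itself, under each sigma_x. *)

(** * Splitting off a finite kernel *)

Lemma exists_additive (A V : zmodType) (h : A -> V) :
  {morph h : a b / a + b} -> exists F : {additive A -> V}, F =1 h.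
Proof.
move=> hD; have hB : zmod_morphism h.
  by move=> a b; apply/eqP; rewrite eq_sym subr_eq -hD subrK.
by exists (HB.pack h (GRing.isZmodMorphism.Build A V h hB) : {additive A -> V}).
Qed.

(** A surjection from a finite type gives, by choice, an injection back, which
    carries the finite structure over to V without changing its addition. *)
Lemma finite_zmod_copy (V : zmodType) (F : finType) (g : F -> V) :
  (forall v, exists c, g c = v) ->
  exists (T : finZmodType) (f : {additive V -> T}), bijective f.
Proof.
move=> /choice[h hK].
pose cnt := CanIsCountable hK.
pose eT : countType := HB.pack (V : Type) (Choice.on V) cnt.
pose fin : isFinite eT := @CanIsFinite eT F h g hK.
pose T : finZmodType := HB.pack (V : Type) (GRing.Zmodule.on V) cnt fin.
by exists T, (idfun : {additive V -> V}); exists id.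
Qed.

(** The kernel is bundled as a type so that it can be a summand of A. *)
Section Kernel.
Variables (A B : zmodType) (f : {additive A -> B}).

Definition kerpred : {pred A} := [pred a | f a == 0].

Lemma kerpred_zmod_closed : zmod_closed kerpred.
Proof.
split=> [|a b]; rewrite !inE ?raddf0 // raddfB => /eqP-> /eqP->.
by rewrite subrr.
Qed.

HB.instance Definition _ :=
  GRing.isZmodClosed.Build A kerpred kerpred_zmod_closed.

Record kernel := Kernel { kernel_val : A; _ : kernel_val \in kerpred }.

HB.instance Definition _ := [isSub for kernel_val].
HB.instance Definition _ := [Choice of kernel by <:].
HB.instance Definition _ := [SubChoice_isSubZmodule of kernel by <:].

End Kernel.

(** The section s gives A = Z^n + ker f, with projection a - s (f a) onto the
    kernel. Reducing modulo d the coefficients of the torsion elements g i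
    leaves finitely many combinations of them, so the kernel is finite. *)
Lemma has_rank_split_torsion (A : zmodType) n
    (f : {additive A -> 'rV[int]_n}) (s : {additive 'rV[int]_n -> A})
    (I : finType) (g : I -> A) (d : nat) :
  cancel s f -> (0 < d)%N -> (forall i, g i *+ d = 0) ->
  (forall a, exists c : I -> int, a - s (f a) = \sum_i g i *~ c i) ->
  has_rank A n.
Proof.
move=> sK d_gt0 gd gen.
have prK a : a - s (f a) \in kerpred f by rewrite inE raddfB /= sK subrr.
pose pr a : kernel f := Kernel (prK a).
have prD : {morph pr : a b / a + b}.
  by move=> a b; apply: val_inj; rewrite /= !raddfD /= addrACA.
have pr_val t : pr (val t) = t.
  by apply: val_inj; case: t => t /= /eqP->; rewrite raddf0 subr0.
have [T [h [h' hK h'K]]] : exists (T : finZmodType)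
    (h : {additive kernel f -> T}), bijective h.
  apply: (@finite_zmod_copy _ {ffun I -> 'I_d}
            (fun c => pr (\sum_i g i *+ c i))) => t.
  have [c tE] := gen (val t).
  have cP i : (`|(c i %% d)%Z| < d)%N.
    by rewrite -ltz_nat gez0_abs ?modz_ge0 ?ltz_pmod ?eqz_nat ?lt0n_neq0.
  exists [ffun i => Ordinal (cP i)]; rewrite -[RHS]pr_val; congr pr.
  (* val t is written as its own projection, since gen describes projections. *)
  have /eqP-> : val t == val (pr (val t)) by rewrite pr_val.
  rewrite /= tE; apply: eq_bigr => i _; rewrite ffunE /=.
  rewrite pmulrn gez0_abs ?modz_ge0 ?eqz_nat ?lt0n_neq0 //.
  by rewrite [c i in RHS](divz_eq _ d) [RHS]mulrzDr (mulrC _ d%:Z) mulrzA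
    -pmulrn gd mul0rz add0r.
have [F FE] : exists F : {additive A -> 'rV[int]_n * T},
    F =1 fun a => (f a, h (pr a)).
  by apply: exists_additive => a b; rewrite prD !raddfD.
exists T, F; exists (fun p => s p.1 + val (h' p.2)) => [a|[v t]].
  by rewrite FE /= hK /= addrC subrK.
have ft : f (val (h' t)) = 0 by apply/eqP; case: (h' t).
rewrite FE /= raddfD /= sK ft addr0; congr (_, _).
rewrite prD pr_val [pr (s v)](_ : _ = 0) ?add0r ?h'K //.
by apply: val_inj; rewrite /= sK subrr.
Qed.

(** * Duality between integer relations and rational functionals *)

Lemma common_denominator (I : finType) (u : I -> rat) :
  exists2 d : nat, (0 < d)%N &
    exists w : I -> int, forall i, u i * d%:R = (w i)%:~R.
Proof.
exists (\prod_i `|denq (u i)|)%N.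
  by apply: prodn_gt0 => i; rewrite absz_gt0 denq_neq0.
exists (fun i => numq (u i) * (\prod_(j | j != i) `|denq (u j)|)%N) => i.
rewrite (bigD1 i) //= natrM mulrA rmorphM /=; congr (_ * _).
by rewrite pmulrn absz_denq -{1}[u i]divq_num_den divfK // intr_eq0 denq_neq0.
Qed.

(** The Fredholm alternative over Q: the columns of cokermx M are functionals
    that vanish on the rows of M, and a row vector killed by all of them lies
    in the row space of M. Clearing denominators makes the combination
    integral, at the cost of a multiple of v. *)
Lemma int_fredholm (P X : finType) (R : P -> X -> int) (v : X -> int) :
  (forall phi : X -> rat,
     (forall p, \sum_x phi x *~ R p x = 0) -> \sum_x phi x *~ v x = 0) ->
  exists2 d : nat, (0 < d)%N &
    exists w : P -> int, forall x, v x *+ d = \sum_p R p x *~ w p.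
Proof.
move=> ann.
pose M : 'M[rat]_(#|P|, #|X|) :=
  \matrix_(i, j) (R (enum_val i) (enum_val j))%:~R.
pose V : 'rV[rat]_#|X| := \row_j (v (enum_val j))%:~R.
have : (V <= M)%MS.
  rewrite submxE; apply/eqP/rowP=> j.
  move: (cokermx M) (mulmx_coker M) => C MC; rewrite !mxE.
  transitivity (\sum_x C (enum_rank x) j *~ v x).
    rewrite [RHS](reindex _ (onW_bij _ (@enum_val_bij X))).
    by apply: eq_bigr => i _; rewrite mxE enum_valK mulrzl.
  apply: ann => p; transitivity ((M *m C) (enum_rank p) j).
    rewrite mxE (reindex _ (onW_bij _ (@enum_val_bij X))).
    by apply: eq_bigr => i _; rewrite mxE enum_rankK enum_valK mulrzl.
  by rewrite MC mxE.
case/submxP=> u Vu.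
have [d d_gt0 [w wE]] := common_denominator (fun p => u 0 (enum_rank p)).
exists d => //; exists w => x; apply: (@intr_inj rat).
have /rowP/(_ (enum_rank x)) := Vu; rewrite !mxE enum_rankK.
rewrite (reindex _ (onW_bij _ (@enum_rank_bij P))) raddfMn /= => ->.
rewrite -mulr_natr mulr_suml raddf_sum; apply: eq_bigr => p _ /=.
by rewrite mxE !enum_rankK mulrAC wE mulrC -rmorphM /= mulrzz.
Qed.

(** To prove an element of an abelian group torsion, it is enough to test it
    against rational functionals on the generators: this replaces tensoring
    the group with Q. *)
Lemma torsion_of_annihilators (P X : finType) (R : P -> X -> int)
    (v : X -> int) (A : zmodType) (g : X -> A) :
  (forall phi : X -> rat,
     (forall p, \sum_x phi x *~ R p x = 0) -> \sum_x phi x *~ v x = 0) ->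
  (forall p, \sum_x g x *~ R p x = 0) ->
  exists2 d : nat, (0 < d)%N & (\sum_x g x *~ v x) *+ d = 0.
Proof.
move=> /int_fredholm[d d_gt0 [w wE]] gR; exists d => //.
rewrite -sumrMnl (eq_bigr (fun x => \sum_p g x *~ R p x *~ w p)) => [|x _].
  by rewrite exchange_big big1 // => p _; rewrite -mulrz_suml gR mul0rz.
rewrite pmulrn -mulrzA -mulrzz -pmulrn wE mulrz_sumr.
by apply: eq_bigr => p _; rewrite -mulrzA mulrzz.
Qed.

(** * Abelianizations of presented groups *)

Lemma abelianization_lift (G : groupType) (V : zmodType) (h : G -> V) :
  (forall x y, h (x * y)%g = h x + h y) ->
  exists F : {additive abelianization G -> V},
    forall x, F (\pi_(abelianization G) x) = h x.
Proof.
move=> hM; have h1 : h 1%g = 0.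
  by apply: (addIr (h 1%g)); rewrite -hM mulg1 add0r.
have hV x : h x^-1%g = - h x.
  by apply/eqP; rewrite -addr_eq0 -hM mulVg h1.
have h_derived x : derived x -> h x = 0.
  elim=> [|y z _ hy _ hz|y _ hy|y z] //.
  - by rewrite hM hy hz addr0.
  - by rewrite hV hy oppr0.
  - by rewrite /commg /conjg !hM !hV addrCA addKr addNr.
have h_pi x : h (repr (\pi_(abelianization G) x)) = h x.
  apply/eqP; rewrite -subr_eq0 -oppr_eq0 opprB addrC -hV -hM.
  by rewrite h_derived //; apply: repr_ab.
have [F FE] : exists F : {additive abelianization G -> V},
    F =1 fun a => h (repr a).
  apply: exists_additive => a b; rewrite -hM.
  by rewrite -[a in LHS]reprK -[b in LHS]reprK [_ + _]pi_ab_add h_pi.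
by exists F => x; rewrite FE h_pi.
Qed.

Definition word_eval (X : Type) (V : zmodType) (phi : X -> V) (w : word X) :=
  \sum_(a <- w) (if a.2 then - phi a.1 else phi a.1).

Lemma word_eval_cat (X : Type) (V : zmodType) (phi : X -> V) (u v : word X) :
  word_eval phi (u ++ v) = word_eval phi u + word_eval phi v.
Proof. exact: big_cat. Qed.

Lemma word_eval_letter (X : Type) (V : zmodType) (phi : X -> V) (x : X) :
  word_eval phi (letter x) = phi x.
Proof. exact: big_seq1. Qed.

(** The coefficient of phi x is the exponent sum of x in w, which is itself an
    evaluation, in the integers. *)
Lemma word_eval_coef (X : finType) (V : zmodType) (phi : X -> V) (w : word X) :
  word_eval phi w =
  \sum_x phi x *~ word_eval (fun y => (y == x)%:R : int) w.
Proof.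
elim: w => [|a w IHw].
  by rewrite /word_eval big_nil big1 // => x _; rewrite big_nil mulr0z.
rewrite -cat1s word_eval_cat IHw (eq_bigr _ (fun x _ =>
  congr1 _ (word_eval_cat _ [:: a] w))) /=.
under [RHS]eq_bigr do rewrite mulrzDr.
rewrite big_split /=; congr (_ + _).
rewrite /word_eval big_seq1 (bigD1 a.1) //= [X in _ + X]big1 ?addr0 => [|x xa].
  by rewrite big_seq1 eqxx; case: a.2; rewrite ?mulrNz.
by rewrite big_seq1 eq_sym (negPf xa) oppr0 if_same mulr0z.
Qed.

Lemma word_eval_cong (X : Type) (R : word X -> word X -> Prop) (V : zmodType)
    (phi : X -> V) :
  (forall u v, R u v -> word_eval phi u = word_eval phi v) ->
  forall u v, pres_cong R u v -> word_eval phi u = word_eval phi v.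
Proof.
move=> phiR u v; elim=> {u v} // [u v w _ -> _ ->|u u' v v' _ uE _ vE|x b].
- by [].
- by rewrite !word_eval_cat uE vE.
- rewrite /word_eval big_cons big_seq1 big_nil /=.
  by case: b; rewrite /= ?addNr ?subrr.
Qed.

Definition ab_letter (X : choiceType) (R : word X -> word X -> Prop) (x : X) :
    abelianization (presented_group R) :=
  \pi_(abelianization (presented_group R))
    (\pi_(presented_group R) (letter x) : presented_group R).

Lemma pi_pres_cat (X : choiceType) (R : word X -> word X -> Prop)
    (u v : word X) :
  \pi_(presented_group R) (u ++ v) =
  (\pi_(presented_group R) u * \pi_(presented_group R) v)%g
    :> presented_group R.
Proof.
by apply/pi_presP; apply: pres_cat; apply: pres_sym; apply: repr_pres.
Qed.

(** The class of a word is its evaluation at the classes of its letters; this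
    is what makes the letters generate the abelianization. *)
Lemma pi_pi_word (X : choiceType) (R : word X -> word X -> Prop) (w : word X) :
  \pi_(abelianization (presented_group R))
    (\pi_(presented_group R) w : presented_group R) =
  word_eval (@ab_letter X R) w.
Proof.
elim: w => [|[x b] w IHw]; first by rewrite /word_eval big_nil.
rewrite -cat1s word_eval_cat -IHw pi_pres_cat -pi_ab_add; congr (_ + _).
rewrite /word_eval big_seq1 /=; case: b => //.
apply/eqP; rewrite -addr_eq0 /ab_letter [_ + _]pi_ab_add -pi_pres_cat.
by apply/eqP; congr (\pi _); apply/pi_presP; apply: (@pres_cancel _ R x true).
Qed.

Lemma ab_presented_gen (X : finType) (R : word X -> word X -> Prop)
    (a : abelianization (presented_group R)) :
  exists c : X -> int, a = \sum_x ab_letter R x *~ c x.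
Proof.
exists (fun x => word_eval (fun y => (y == x)%:R : int) (repr (repr a))).
by rewrite -word_eval_coef -pi_pi_word !reprK.
Qed.

Lemma ab_presented_lift (X : choiceType) (R : word X -> word X -> Prop)
    (V : zmodType) (phi : X -> V) :
  (forall u v, R u v -> word_eval phi u = word_eval phi v) ->
  exists F : {additive abelianization (presented_group R) -> V},
    forall x, F (ab_letter R x) = phi x.
Proof.
move=> phiR; have congE := word_eval_cong phiR.
have [|F FE] := @abelianization_lift (presented_group R) V
  (fun g => word_eval phi (repr g)).
  by move=> g h; rewrite -word_eval_cat; apply: congE; apply: repr_pres.
exists F => x; rewrite FE -[RHS](word_eval_letter phi).
by apply: congE; apply: repr_pres.
Qed.

(** * Additive functions on a solution *)

(** phi x is the average of phi over the points tau_y x; since each tau_y is a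
    permutation, the sum of the squares (phi (tau_y x) - phi x)^2 vanishes. *)
Lemma sigma_tau_invariant (X : finType) (r : X * X -> X * X)
    (F : realDomainType) (phi : X -> F) :
  (forall x, injective (sigma r x)) -> (forall y, injective (tau r y)) ->
  (forall x y, phi x + phi y = phi (sigma r x y) + phi (tau r y x)) ->
  (forall x y, phi (tau r y x) = phi x) /\
  (forall x y, phi (sigma r x y) = phi y).
Proof.
move=> sigmaI tauI phiR.
have mean x : \sum_y phi (tau r y x) = phi x *+ #|X|.
  have : \sum_y (phi x + phi y) = \sum_y (phi (sigma r x y) + phi (tau r y x)).
    by apply: eq_bigr => y _; apply: phiR.
  rewrite !big_split /= sumr_const addrC [\sum_y phi y](reindex_inj (sigmaI x)).
  by move=> /addrI.
have tau_inv x y : phi (tau r y x) = phi x.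
  have sq0 : \sum_x \sum_y (phi (tau r y x) - phi x) ^+ 2 = 0.
    (* The squares of the phi (tau_y x) sum to N because tau_y permutes X, and
       the products phi (tau_y x) * phi x because phi x is a mean. *)
    pose N := \sum_x phi x ^+ 2 *+ #|X|.
    have sq_tau : \sum_x \sum_y phi (tau r y x) ^+ 2 = N.
      rewrite exchange_big /= (eq_bigr (fun=> \sum_x phi x ^+ 2)) => [|z _].
        by rewrite sumr_const -sumrMnl.
      by rewrite [RHS](reindex_inj (tauI z)).
    have sq_mix : \sum_x \sum_y phi (tau r y x) * phi x = N.
      by apply: eq_bigr => z _; rewrite -mulr_suml mean mulrnAl.
    under eq_bigr do under eq_bigr do rewrite sqrrB.
    under eq_bigr do rewrite big_split sumrB sumrMnl sumr_const /=.
    by rewrite big_split sumrB sumrMnl sq_tau sq_mix /= -/N mulr2n opprD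
      addrA subrr sub0r addNr.
  apply/eqP; rewrite -subr_eq0 -sqrf_eq0.
  move: sq0 => /psumr_eq0P sq0.
  have sqx := sq0 (fun z _ => sumr_ge0 _ (fun y _ => sqr_ge0 _)) x isT.
  by rewrite (psumr_eq0P _ sqx) // => z _; apply: sqr_ge0.
split=> // x y; apply: (addIr (phi (tau r y x))).
by rewrite -phiR tau_inv addrC.
Qed.

(** * The rank of the abelianized structure group *)

Lemma invariant_on_orbit (X : finType) (T : eqType) (phi : X -> T)
    (S : {set {perm X}}) :
  (forall s, s \in S -> forall x, phi (s x) = phi x) ->
  forall x y, y \in orbit 'P <<S>>%g x -> phi y = phi x.
Proof.
move=> phiS x _ /orbitP[g /gen_prodgP[n [s sS ->]] <-] /=; rewrite apermE.
move: x; apply: (big_ind (fun g : {perm X} => forall x, phi (g x) = phi x)).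
- by move=> x; rewrite perm1.
- by move=> h k hE kE x; rewrite permM kE hE.
- by move=> i _; apply: phiS.
Qed.

Lemma mem_orbit_sigma_tau (X : finType) (r : X * X -> X * X) (t : X -> X) z :
  injective t -> t =1 sigma r z \/ t =1 tau r z ->
  forall x, t x \in orbit 'P <<sigma_tau_perms r>>%g x.
Proof.
move=> tI tE x; rewrite -(permE tI x) -apermE; apply: mem_orbit.
apply: mem_gen; rewrite inE; apply/existsP; exists z.
by case: tE => tE; apply/orP; [left | right]; apply/forallP=> y;
  rewrite permE tE.
Qed.

Lemma sum_mulrz_delta (X : finType) (V : zmodType) (g : X -> V) (x : X) :
  \sum_z g z *~ (z == x)%:R = g x.
Proof.
rewrite (bigD1 x) //= eqxx big1 ?addr0 // => z /negPf->.
by rewrite mulr0z.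
Qed.

Lemma structure_ab_rel (X : finType) (r : X * X -> X * X) (x y : X) :
  ab_letter (structure_rel r) x + ab_letter (structure_rel r) y =
  ab_letter (structure_rel r) (sigma r x y) +
  ab_letter (structure_rel r) (tau r y x).
Proof.
rewrite /ab_letter ![_ + _]pi_ab_add -!pi_pres_cat.
by congr (\pi _); apply/pi_presP; apply/pres_defrel/StructureRel.
Qed.

(** The relations of the structure group, read as equations on a rational
    functional phi, are those of sigma_tau_invariant; such a phi does not
    separate points of the same orbit. *)
Lemma orbit_torsion (X : finType) (r : X * X -> X * X) (x x' : X) :
  (forall x, injective (sigma r x)) -> (forall y, injective (tau r y)) ->
  x' \in orbit 'P <<sigma_tau_perms r>>%g x ->
  exists2 d : nat, (0 < d)%N &
    (ab_letter (structure_rel r) x - ab_letter (structure_rel r) x') *+ d = 0.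
Proof.
move=> sigmaI tauI xx'.
pose e (z y : X) : int := (y == z)%:R.
pose R (p : X * X) z :=
  e p.1 z + e p.2 z - (e (sigma r p.1 p.2) z + e (tau r p.2 p.1) z).
pose v z := e x z - e x' z.
have eR (V : zmodType) (g : X -> V) p : \sum_z g z *~ R p z =
    g p.1 + g p.2 - (g (sigma r p.1 p.2) + g (tau r p.2 p.1)).
  under eq_bigr do rewrite mulrzBr !mulrzDr.
  by rewrite sumrB !big_split /= !sum_mulrz_delta.
have ev (V : zmodType) (g : X -> V) : \sum_z g z *~ v z = g x - g x'.
  by under eq_bigr do rewrite mulrzBr; rewrite sumrB !sum_mulrz_delta.
rewrite -ev; apply: (@torsion_of_annihilators _ _ R) => [phi phiR|[y z]].
  have [y z|phi_tau phi_sigma] := sigma_tau_invariant (phi := phi) sigmaI tauI.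
    by apply/eqP; rewrite -subr_eq0 -(eR _ phi (y, z)) phiR.
  rewrite ev (invariant_on_orbit _ xx') ?subrr // => s.
  rewrite inE => /existsP[z /orP[]/forallP sE] y.
    by rewrite (eqP (sE y)).
  by rewrite (eqP (sE y)).
by rewrite eR /= structure_ab_rel subrr.
Qed.

Theorem proposition6p3 (X : finType) (r : X * X -> X * X)
    (hr : is_solution r) :
  has_rank (abelianization (structure_group r)) #|orbits r|.
Proof.
case: hr => _ _ sigma_bij tau_bij.
have sigmaI x : injective (sigma r x) by apply: bij_inj.
have tauI y : injective (tau r y) by apply: bij_inj.
pose orb x := orbit 'P <<sigma_tau_perms r>>%g x.
have orbP x : orb x \in orbits r by apply: imset_f.
pose idx x := enum_rank_in (orbP x) (orb x).
have idxE x : enum_val (idx x) = orb x by apply: enum_rankK_in.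
have idx_orb x y : y \in orb x -> idx y = idx x.
  by move=> yx; apply: enum_val_inj; rewrite !idxE; apply/orbit_eqP.
have /choice[rep repK] i : exists x, idx x = i.
  have /imsetP[x _ iE] := enum_valP i.
  by exists x; apply: enum_val_inj; rewrite idxE iE.
pose gen x := ab_letter (structure_rel r) x.
have [f fE] : exists f : {additive abelianization (structure_group r) ->
    'rV[int]_#|orbits r|}, forall x, f (gen x) = delta_mx 0 (idx x).
  apply: ab_presented_lift => _ _ [x y].
  rewrite !word_eval_cat !word_eval_letter addrC.
  rewrite (idx_orb y (sigma r x y)) ?(idx_orb x (tau r y x)) //.
    by apply: (mem_orbit_sigma_tau (z := y)) => //; right.
  by apply: (mem_orbit_sigma_tau (z := x)) => //; left.
have [s sE] : exists s : {additive 'rV[int]_#|orbits r| ->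
    abelianization (structure_group r)},
    s =1 fun v => \sum_i gen (rep i) *~ v 0 i.
  apply: exists_additive => u v; rewrite -big_split; apply: eq_bigr => i _.
  by rewrite mxE mulrzDr.
have s_delta i : s (delta_mx 0 i) = gen (rep i).
  rewrite sE -[RHS](sum_mulrz_delta (fun i => gen (rep i))).
  by apply: eq_bigr => j _; rewrite mxE eqxx.
have sK : cancel s f.
  move=> v; rewrite sE raddf_sum [RHS]row_sum_delta; apply: eq_bigr => i _.
  by rewrite raddfMz /= fE repK -scaler_int intz.
have /choice[d dE] x : exists n : nat,
    (0 < n)%N /\ (gen x - gen (rep (idx x))) *+ n = 0.
  case: (@orbit_torsion X r x (rep (idx x))) => //.
    by rewrite -/(orb x) -idxE -[in enum_val _](repK (idx x)) idxE orbit_refl.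
  by move=> n; exists n.
apply: (has_rank_split_torsion (g := fun x => gen x - gen (rep (idx x)))
          (d := \prod_x d x) sK).
- by apply: prodn_gt0 => x; have [] := dE x.
- by move=> x; rewrite (bigD1 x) //= mulrnA (dE x).2 mul0rn.
move=> a; have [c aE] := ab_presented_gen a; exists c.
rewrite {1}aE {1}aE (raddf_sum f) (raddf_sum s) -sumrB; apply: eq_bigr => x _.
by rewrite (raddfMz f) (raddfMz s) fE s_delta mulrzBl.
Qed.
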